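(* Let $F,S\in\mathcal{C}(I,\mathcal{K}(\mathbb{R}))$ satisfy $S(u_1)-F(u_1)=S(u_N)-F(u_N)$, let $\alpha\in(-1,1)$, and let $F^{\alpha}$ be the $\alpha$-fractal function corresponding to $F$ (with respect to the partition $\Delta$ and base function $S$). Then $$\|F^{\alpha}-F\|_{\infty}\le\frac{|\alpha|}{1-|\alpha|}\|F-S\|_{\infty}+\frac{2|\alpha|}{1-|\alpha|}\|F\|_{\infty}.$$
   Context: $\mathcal{K}(\mathbb{R})$ is the collection of nonempty compact subsets of $\mathbb{R}$, with the Hausdorff metric $H_d(A,B)=\max\{\sup_{a\in A}\inf_{b\in B}|a-b|,\ \sup_{b\in B}\inf_{a\in A}|b-a|\}$. For $A,B\in\mathcal{K}(\mathbb{R})$, $\lambda\in\mathbb{R}$: $A+B=\{a+b\}$ (Minkowski sum), $\lambda A=\{\lambda a\}$, $A-B=\{a-b:a\in A,b\in B\}$. $\mathcal{C}(I,\mathcal{K}(\mathbb{R}))$ is the set of continuous maps $I\to\mathcal{K}(\mathbb{R})$. Notation: $\|G-H\|_\infty$ denotes $\sup_{u\in I}H_d(G(u),H(u))$, and $\|F\|_\infty=\sup_{u\in I}H_d(F(u),\{0\})$. Setting: $I=[u_1,u_N]$ with partition $\Delta: u_1<\cdots<u_N$, $J=\{1,\ldots,N-1\}$, $I_j=[u_j,u_{j+1}]$, and $L_j:I\to I_j$ is the affine contraction $L_j(u)=a_ju+b_j$ with $L_j(u_1)=u_j$, $L_j(u_N)=u_{j+1}$, so $a_j=\frac{u_{j+1}-u_j}{u_N-u_1}$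 and $0<a_j<1$. For $\alpha\in(-1,1)$ and $F,S\in\mathcal{C}(I,\mathcal{K}(\mathbb{R}))$ with $S(u_1)-F(u_1)=S(u_N)-F(u_N)$, the $\alpha$-fractal function $F^\alpha$ is the unique element of $\mathcal{C}(I,\mathcal{K}(\mathbb{R}))$ with $F^{\alpha}(u)=F(u)+\alpha[F^{\alpha}(L_j^{-1}(u))-S(L_j^{-1}(u))]$ for every $u\in I_j$, $j\in J$. *)

(* Defs.v *)
From HB Require Import structures.
From mathcomp Require Import all_boot all_order all_algebra.
From mathcomp Require Import mathcomp_extra boolp classical_sets functions.
From mathcomp Require Import set_interval reals topology normedtype derive.
From mathcomp Require Import ring lra.

Set Implicit Arguments.
Unset Strict Implicit.
Unset Printing Implicit Defensive.

Import Order.TTheory GRing.Theory Num.Theory.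
Import numFieldNormedType.Exports.

Local Open Scope classical_set_scope.
Local Open Scope ring_scope.

Record compacts (R : realType) : Type := Compacts {
  cset :> set R ;
  cset_nonempty : cset !=set0 ;
  cset_compact : compact cset }.

HB.instance Definition _ (R : realType) := gen_eqMixin (compacts R).
HB.instance Definition _ (R : realType) := gen_choiceMixin (compacts R).

Lemma compacts_inj (R : realType) (A B : compacts R) :
  cset A = cset B -> A = B.
Proof.
case: A => A A0 cA; case: B => B B0 cB /= AB; move: A0 cA B0 cB.
by rewrite AB => *; congr Compacts; exact: Prop_irrelevance.
Qed.

Definition hausdorff (R : realType) (A B : set R) : R :=
  Num.max (sup [set inf [set `|a - b| | b in B] | a in A])
          (sup [set inf [set `|b - a| | a in A] | b in B]).

Section hausdorff_metric.
Variable R : realType.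
Implicit Types (A B C : compacts R) (x y : R).

Let pd x (B : set R) : R := inf [set `|x - b| | b in B].
Let ex (A B : set R) : R := sup [set pd a B | a in A].

Let pd_inf x B : has_inf [set `|x - b| | b in B].
Proof.
split; first by have [b Bb] := cset_nonempty B; exists `|x - b|; exists b.
by exists 0 => _ [b _ <-].
Qed.

Let pd_le x B b : cset B b -> pd x B <= `|x - b|.
Proof. by move=> Bb; apply: ge_inf; [case: (pd_inf x B)|exists b]. Qed.

Let pd_ge x B e : (forall b, cset B b -> e <= `|x - b|) -> e <= pd x B.
Proof.
move=> H; apply: lb_le_inf; first by case: (pd_inf x B).
by move=> _ [b Bb <-]; exact: H.
Qed.

Let pd_min x B : exists2 b, cset B b & pd x B = `|x - b|.
Proof.
have cd : {within (cset B), continuous (fun b => `|x - b|)}.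
  apply: continuous_subspaceT => b; apply: cvg_norm.
  by apply: cvgB; [exact: cvg_cst|exact: cvg_id].
have [b /[!inE] Bb H] :=
  compact_EVT_min (cset_nonempty B) (@cset_compact R B) cd.
exists b => //; apply/eqP; rewrite eq_le pd_le//=.
by apply: pd_ge => c Bc; apply: H; rewrite inE.
Qed.

Let ex_sup A B : has_sup [set pd a B | a in A].
Proof.
have [a Aa] := cset_nonempty A; have [b Bb] := cset_nonempty B.
split; first by exists (pd a B); exists a.
have [M [_ /(_ (M + 1))]] := compact_bounded (@cset_compact R A).
rewrite ltrDl ltr01 => /(_ isT) HM.
exists (M + 1 + `|b|) => _ [c Ac <-].
by rewrite (le_trans (pd_le _ Bb))// (le_trans (ler_normB _ _))// lerD// HM.
Qed.

Let ex_ge A B a : cset A a -> pd a B <= ex A B.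
Proof. by move=> Aa; apply: ub_le_sup; [case: (ex_sup A B)|exists a]. Qed.

Let ex_le A B e : (forall a, cset A a -> pd a B <= e) -> ex A B <= e.
Proof.
move=> H; apply: ge_sup; first by case: (ex_sup A B).
by move=> _ [a Aa <-]; exact: H.
Qed.

Let ex_triangle B A C : ex A C <= ex A B + ex B C.
Proof.
apply: ex_le => a Aa; have [b Bb ab] := pd_min a B.
have [c Cc bc] := pd_min b C.
rewrite (le_trans (pd_le _ Cc))// (le_trans (ler_distD b _ _))//.
by rewrite lerD// -?ab -?bc ex_ge.
Qed.

Let ex_sub A B : ex A B <= 0 -> cset A `<=` cset B.
Proof.
move=> AB a Aa; have [b Bb ab] := pd_min a B.
have : `|a - b| <= 0 by rewrite -ab (le_trans (ex_ge _ Aa)).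
by rewrite normr_le0 subr_eq0 => /eqP ->.
Qed.

Let hausdorffE A B : hausdorff A B = Num.max (ex A B) (ex B A).
Proof. by []. Qed.

Lemma hausdorffxx A : hausdorff A A = 0.
Proof.
rewrite hausdorffE maxxx; apply/eqP; rewrite eq_le; apply/andP; split.
  by apply: ex_le => a Aa; rewrite (le_trans (pd_le _ Aa))// subrr normr0.
have [a Aa] := cset_nonempty A.
by rewrite (le_trans _ (ex_ge _ Aa))//; apply: pd_ge.
Qed.

Lemma hausdorff_eq0 A B : hausdorff A B = 0 -> A = B.
Proof.
move=> AB0; apply/compacts_inj/seteqP.
by split; apply: ex_sub; rewrite -AB0 hausdorffE le_max lexx ?orbT.
Qed.

Lemma hausdorffC A B : hausdorff A B = hausdorff B A.
Proof. by rewrite !hausdorffE maxC. Qed.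

Lemma hausdorff_triangle B A C :
  hausdorff A C <= hausdorff A B + hausdorff B C.
Proof.
rewrite !hausdorffE ge_max; apply/andP; split.
  by rewrite (le_trans (ex_triangle B A C))// lerD// le_max lexx.
by rewrite (le_trans (ex_triangle B C A))// addrC lerD// le_max lexx orbT.
Qed.

End hausdorff_metric.

HB.instance Definition _ (R : realType) := @isMetric.Build R (compacts R)
  (fun A B => hausdorff A B) (@hausdorffxx R) (@hausdorff_eq0 R)
  (@hausdorffC R) (@hausdorff_triangle R).

Lemma mdist_hausdorff (R : realType) (A B : compacts R) :
  mdist A B = hausdorff A B.
Proof. by []. Qed.

Section minkowski.
Variable R : realType.
Implicit Types A B : compacts R.

Let img2_nonempty (f : R -> R -> R) A B : [set f a b | a in A & b in B] !=set0.
Proof.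
have [a Aa] := cset_nonempty A; have [b Bb] := cset_nonempty B.
by exists (f a b); exists a => //; exists b.
Qed.

Let img2_compact (f : R * R -> R) A B : continuous f ->
  compact [set f (a, b) | a in A & b in B].
Proof.
move=> cf.
have -> : [set f (a, b) | a in A & b in B] = f @` (A `*` B).
  apply/seteqP; split=> [_ [a Aa [b Bb <-]]|_ [[a b] [/= Aa Bb] <-]].
    by exists (a, b).
  by exists a => //; exists b.
apply: continuous_compact; first exact: continuous_subspaceT.
by apply: compact_setX; exact: cset_compact.
Qed.

Let addc : continuous (fun z : R * R => z.1 + z.2).
Proof. by move=> z; apply: cvgD; [exact: cvg_fst|exact: cvg_snd]. Qed.

Let subc : continuous (fun z : R * R => z.1 - z.2).
Proof. by move=> z; apply: cvgB; [exact: cvg_fst|exact: cvg_snd]. Qed.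

Definition msum A B : compacts R :=
  Compacts (img2_nonempty +%R A B) (@img2_compact _ A B addc).

Definition mdiff A B : compacts R :=
  Compacts (img2_nonempty (fun a b => a - b) A B) (@img2_compact _ A B subc).

Let scale_nonempty (l : R) A : [set l * a | a in A] !=set0.
Proof. by have [a Aa] := cset_nonempty A; exists (l * a); exists a. Qed.

Let scale_compact (l : R) A : compact [set l * a | a in A].
Proof.
apply: continuous_compact (@cset_compact R A).
by apply: continuous_subspaceT => x; apply: cvgMr; exact: cvg_id.
Qed.

Definition mscale (l : R) A : compacts R :=
  Compacts (scale_nonempty l A) (@scale_compact l A).

Definition csingle (x : R) : compacts R :=
  Compacts (ex_intro [set x] x erefl) (@compact_set1 _ x).

End minkowski.

(* [sup] is the real-valued supremum, which is 0 on unbounded sets; it is the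
   usual supremum when G and H are continuous on a segment I *)
Definition supdist (R : realType) (I : set R) (G H : R -> compacts R) : R :=
  sup [set hausdorff (G x) (H x) | x in I].

Definition supnorm (R : realType) (I : set R) (G : R -> compacts R) : R :=
  supdist I G (fun=> csingle 0).

(* nodes are u 1 < ... < u N; the values of u outside 1..N are irrelevant *)
Definition is_partition (R : realType) (N : nat) (u : nat -> R) : Prop :=
  (1 < N)%N /\ forall j, (1 <= j < N)%N -> u j < u j.+1.

Section affine_maps.
Variables (R : realType) (N : nat) (u : nat -> R).

Definition slope (j : nat) : R := (u j.+1 - u j) / (u N - u 1%N).
Definition offset (j : nat) : R := u j - slope j * u 1%N.
Definition Lmap (j : nat) (x : R) : R := slope j * x + offset j.
Definition Linv (j : nat) (x : R) : R := (x - offset j) / slope j.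

Hypothesis uP : is_partition N u.

Lemma partition_lt : u 1%N < u N.
Proof.
case: uP => N1 H.
have : forall k, (1 < k <= N)%N -> u 1%N < u k.
  elim=> [//|[//|k] IH] /andP[_ kN]; case: k IH kN => [|k] IH kN.
    exact: H.
  by apply: lt_trans (IH _) (H _ _); rewrite ?kN ?(ltnW kN).
by apply; rewrite N1 leqnn.
Qed.

Lemma slope_gt0 j : (1 <= j < N)%N -> 0 < slope j.
Proof.
by move=> jN; rewrite divr_gt0// subr_gt0 ?partition_lt//; exact: uP.2.
Qed.

Lemma Lmap_first j : Lmap j (u 1%N) = u j.
Proof. by rewrite /Lmap /offset addrC subrK. Qed.

Lemma Lmap_last j : Lmap j (u N) = u j.+1.
Proof.
rewrite /Lmap /offset /slope; have := partition_lt.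
by rewrite -subr_gt0 => /lt0r_neq0 ?; field.
Qed.

Lemma LmapK j : (1 <= j < N)%N -> cancel (Lmap j) (Linv j).
Proof.
move=> /slope_gt0/lt0r_neq0 ? x; rewrite /Lmap /Linv addrK mulrC mulKf//.
Qed.

Lemma LinvK j : (1 <= j < N)%N -> cancel (Linv j) (Lmap j).
Proof.
by move=> /slope_gt0/lt0r_neq0 ? x; rewrite /Lmap /Linv mulrC divfK// subrK.
Qed.

End affine_maps.

(* elements of C(I, K(R)) are represented by total functions continuous within
   I; only their restrictions to I matter. The right-hand side is contracting
   in Fa with ratio |alpha|, so at most one Fa (up to its values outside I)
   satisfies this predicate: it is "the" fractal function of F and S. *)
Definition is_fractal_function (R : realType) (N : nat) (u : nat -> R)
    (alpha : R) (F S Fa : R -> compacts R) : Prop :=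
  {within `[u 1%N, u N], continuous Fa} /\
  forall j, (1 <= j < N)%N -> forall x, x \in `[u j, u j.+1] ->
    Fa x = msum (F x)
      (mscale alpha (mdiff (Fa (Linv N u j x)) (S (Linv N u j x)))).

(* Main.v *)
Require Import Defs.
From mathcomp Require Import all_boot all_order all_algebra.
From mathcomp Require Import classical_sets set_interval reals topology normedtype.
From mathcomp Require Import derive ring lra.

Import Order.TTheory GRing.Theory Num.Theory.
Import numFieldNormedType.Exports.

Local Open Scope classical_set_scope.
Local Open Scope ring_scope.

(** The self-referential equation makes the distance to [F] satisfy a
    contraction-type inequality.  At [x] in [I_j], with [y] the preimage of [x]
    by [L_j], the set [Fa x] is the Minkowski sum of [F x] and
    [alpha * (Fa y - S y)], and adding a set [C] to [F x] moves it by at most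
    the largest modulus in [C] ([hausdorff_msum_le]).  An element [p - s] of
    [Fa y - S y] is estimated by passing through [F y]: [p] lies within
    [H(Fa y, F y)] of a point of [F y], [s] lies within [H(F y, S y)] of
    another one, and two points of [F y] are at most [2 H(F y, {0})] apart
    ([mdiff_norm_le]).  Taking suprema over [x],
      [D <= |alpha| (D + E + 2 M)],
    with [D], [E] and [M] the three uniform distances of the theorem, and
    solving for [D], as [|alpha| < 1], gives the bound.  The suprema are those
    of bounded sets because the Hausdorff distance of two continuous set-valued
    maps is continuous on a compact segment ([hausdorff_le_supdist]). *)

Section hausdorff_pointwise.
Variable R : realType.
Implicit Types (A B C K P Q : compacts R) (a x e r : R).

Lemma compacts_nearest x B :
  exists2 b, cset B b & inf [set `|x - b| | b in B] = `|x - b|.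
Proof.
have cd : {within (cset B), continuous (fun b => `|x - b|)}.
  apply: continuous_subspaceT => b; apply: cvg_norm.
  by apply: cvgB; [exact: cvg_cst|exact: cvg_id].
have [b /[!inE] Bb bmin] :=
  compact_EVT_min (cset_nonempty B) (@cset_compact R B) cd.
exists b => //; apply/eqP; rewrite eq_le; apply/andP; split.
  by apply: ge_inf; [exists 0 => _ [c _ <-]|exists b].
apply: lb_le_inf; first by exists `|x - b|; exists b.
by move=> _ [c Bc <-]; apply: bmin; rewrite inE.
Qed.

Lemma has_ubound_dist_compacts A B :
  has_ubound [set inf [set `|a - b| | b in B] | a in A].
Proof.
have [b Bb] := cset_nonempty B.
have [M [_ /(_ (M + 1))]] := compact_bounded (@cset_compact R A).
rewrite ltrDl ltr01 => /(_ isT) HM.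
exists (M + 1 + `|b|) => _ [a Aa <-].
apply: (@le_trans _ _ `|a - b|).
  by apply: ge_inf; [exists 0 => _ [c _ <-]|exists b].
by rewrite (le_trans (ler_normB _ _))// lerD// HM.
Qed.

(** The distance to a compact set is attained, so that no epsilon appears. *)
Lemma hausdorff_nearby A B a :
  cset A a -> exists2 b, cset B b & `|a - b| <= hausdorff A B.
Proof.
move=> Aa; have [b Bb ab] := compacts_nearest a B; exists b => //.
rewrite -ab /hausdorff le_max; apply/orP; left.
by apply: ub_le_sup; [exact: has_ubound_dist_compacts|exists a].
Qed.

Lemma hausdorff_le A B e :
  (forall a, cset A a -> exists2 b, cset B b & `|a - b| <= e) ->
  (forall b, cset B b -> exists2 a, cset A a & `|b - a| <= e) ->
  hausdorff A B <= e.
Proof.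
have half P Q : (forall p, cset P p -> exists2 q, cset Q q & `|p - q| <= e) ->
    sup [set inf [set `|p - q| | q in Q] | p in P] <= e.
  move=> PQ; apply: ge_sup.
    by have [p Pp] := cset_nonempty P; exists (inf [set `|p - q| | q in Q]), p.
  move=> _ [p Pp <-]; have [q Qq pq] := PQ _ Pp.
  by apply: le_trans pq; apply: ge_inf; [exists 0 => _ [c _ <-]|exists q].
by move=> AB BA; rewrite /hausdorff ge_max !half.
Qed.

Lemma hausdorff_ge0 A B : 0 <= hausdorff A B.
Proof. by rewrite -mdist_hausdorff mdist_ge0. Qed.

Lemma cset_norm_le A a : cset A a -> `|a| <= hausdorff A (csingle 0).
Proof.
by move=> /(@hausdorff_nearby _ (csingle 0))[_ /= ->]; rewrite subr0.
Qed.

Lemma hausdorff_msum_le A C r :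
  (forall c, cset C c -> `|c| <= r) -> hausdorff (msum A C) A <= r.
Proof.
move=> Cr; apply: hausdorff_le => [_ [a Aa [c Cc <-]]|a Aa].
  by exists a => //; rewrite addrAC subrr add0r Cr.
have [c Cc] := cset_nonempty C.
exists (a + c); first by exists a => //; exists c.
by rewrite opprD addNKr normrN Cr.
Qed.

Lemma mdiff_norm_le K P Q x : cset (mdiff P Q) x ->
  `|x| <= hausdorff P K + hausdorff K Q + 2 * hausdorff K (csingle 0).
Proof.
move=> [p Pp [q Qq <-]].
have [k Kk pk] := @hausdorff_nearby P K p Pp.
have [l Kl ql] := @hausdorff_nearby Q K q Qq.
have := cset_norm_le _ _ Kk; have := cset_norm_le _ _ Kl.
move: ql; rewrite (hausdorffC Q K) distrC.
have -> : p - q = (p - k) + (l - q) + (k - l) by ring.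
have := ler_normD ((p - k) + (l - q)) (k - l).
have := ler_normD (p - k) (l - q).
have := ler_normB k l.
lra.
Qed.

End hausdorff_pointwise.

Lemma mdist_quadrilateral (R : realType) (M : metricType R) (p q p' q' : M) :
  `|mdist p q - mdist p' q'| <= mdist p p' + mdist q q'.
Proof.
have t1 := metric_triangle p p' q.
have t2 := metric_triangle p' q' q.
have t3 := metric_triangle p' p q'.
have t4 := metric_triangle p q q'.
rewrite (metric_sym q' q) in t2; rewrite (metric_sym p' p) in t3.
by rewrite ler_norml; apply/andP; split; lra.
Qed.

Lemma within_continuous_mdist (T : topologicalType) (R : realType)
    (M : metricType R) (A : set T) (G H : T -> M) :
  {within A, continuous G} -> {within A, continuous H} ->
  {within A, continuous (fun x => mdist (G x) (H x))}.
Proof.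
move=> cG cH x; apply/cvgrPdist_lt => e e0.
have e2 : 0 < e / 2 by rewrite divr_gt0.
have /metricType_numDomainType.cvgrPdist_lt/(_ _ e2) nG := cG x.
have /metricType_numDomainType.cvgrPdist_lt/(_ _ e2) nH := cH x.
near=> y.
apply: le_lt_trans (mdist_quadrilateral _ _ _ _ _ _) _.
by rewrite (splitr e) ltrD//; near: y.
Unshelve. all: by end_near. Qed.

(** Continuity is what keeps [supdist] from being the default value of the
    supremum of an unbounded set. *)
Lemma hausdorff_le_supdist (R : realType) (a b : R) (G H : R -> compacts R) :
  {within `[a, b], continuous G} -> {within `[a, b], continuous H} ->
  forall x, x \in `[a, b] -> hausdorff (G x) (H x) <= supdist `[a, b] G H.
Proof.
move=> cG cH x xab; apply: ub_le_sup; last by exists x.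
have ab : a <= b by move: xab; rewrite in_itv => /andP[/le_trans]; apply.
have [c _ cmax] := EVT_max ab (within_continuous_mdist _ _ _ _ _ _ cG cH).
exists (mdist (G c) (H c)) => _ [y yab <-].
by rewrite -mdist_hausdorff; exact: cmax.
Qed.

Lemma partition_cover (R : realType) (N : nat) (u : nat -> R) (x : R) :
  (1 < N)%N -> x \in `[u 1%N, u N] ->
  exists2 j, (1 <= j < N)%N & x \in `[u j, u j.+1].
Proof.
elim: N => [//|[//|N] IH] _; rewrite in_itv/= => /andP[u1x xuN].
have [uNx|xuN'] := leP (u N.+1) x.
  by exists N.+1; rewrite ?in_itv/= ?uNx ?xuN// ltnS leqnn.
case: N IH xuN xuN' => [|N] IH xuN xuN'.
  by move: (le_lt_trans u1x xuN'); rewrite ltxx.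
have [||j /andP[j1 jN] xj] := IH; rewrite ?in_itv/= ?u1x ?(ltW xuN')//.
by exists j => //; rewrite j1 ltnW.
Qed.

Lemma Linv_in (R : realType) (N : nat) (u : nat -> R) (j : nat) (x : R) :
  is_partition N u -> (1 <= j < N)%N -> x \in `[u j, u j.+1] ->
  Linv N u j x \in `[u 1%N, u N].
Proof.
move=> uP jN; have sj := slope_gt0 uP jN.
rewrite -{1}(LinvK uP jN x) -{1}(Lmap_first N u j) -{1}(Lmap_last uP j).
by rewrite !in_itv/= /Lmap !lerD2r !ler_pM2l.
Qed.

Theorem proposition4p1 (R : realType) (N : nat) (u : nat -> R) (alpha : R)
    (F S Fa : R -> compacts R)
    (hu : is_partition N u)
    (halpha : -1 < alpha < 1)
    (hF : {within `[u 1%N, u N], continuous F})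
    (hS : {within `[u 1%N, u N], continuous S})
    (hends : mdiff (S (u 1%N)) (F (u 1%N)) = mdiff (S (u N)) (F (u N)))
    (hFa : is_fractal_function N u alpha F S Fa) :
  supdist `[u 1%N, u N] Fa F <=
    `|alpha| / (1 - `|alpha|) * supdist `[u 1%N, u N] F S
    + 2 * `|alpha| / (1 - `|alpha|) * supnorm `[u 1%N, u N] F.
Proof.
have [cFa Fa_eq] := hFa.
have c0 : {within `[u 1%N, u N], continuous (fun=> @csingle R 0)}.
  by move=> x; exact: cvg_cst.
set D := supdist _ Fa F; set E := supdist _ F S; set M := supnorm _ F.
have a1 : 0 < 1 - `|alpha| by rewrite subr_gt0 ltr_norml.
have step : D <= `|alpha| * (D + E + 2 * M).
  apply: ge_sup.
    exists (hausdorff (Fa (u 1%N)) (F (u 1%N))), (u 1%N) => //.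
    by rewrite /= in_itv/= lexx (ltW (partition_lt hu)).
  move=> _ [x xI <-].
  have [j jN xj] := partition_cover _ _ _ _ hu.1 xI.
  have yI := Linv_in _ _ _ _ _ hu jN xj.
  rewrite (Fa_eq _ jN _ xj); apply: hausdorff_msum_le => _ [c cFS <-].
  rewrite normrM ler_wpM2l//.
  apply: le_trans (mdiff_norm_le _ (F (Linv N u j x)) _ _ _ cFS) _.
  apply: lerD; last by rewrite ler_wpM2l//; exact: hausdorff_le_supdist hF c0 _ yI.
  by apply: lerD; exact: hausdorff_le_supdist.
have -> : `|alpha| / (1 - `|alpha|) * E + 2 * `|alpha| / (1 - `|alpha|) * M
    = (`|alpha| * (E + 2 * M)) / (1 - `|alpha|) by ring.
by rewrite ler_pdivlMr//; lra.
Qed.
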